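(* Let $G$ be a finite just non-solvable group. Then the set $$\{P(G,w)\mid w\in F_{\infty}\}$$ is dense in $[0,1]$.
   Context: A group $G$ is just non-solvable if every proper quotient of $G$ (i.e. every quotient by a nontrivial normal subgroup) is solvable, but $G$ itself is not solvable. $F_n$ denotes the free group on $n$ letters and $F_\infty$ the free group on countably infinitely many letters (so every $w\in F_\infty$ lies in some $F_n$). For a finite group $G$ and $w\in F_{n}$, $P(G,w)$ denotes the probability that for $n$ independent uniform random elements $g_{1},\ldots,g_{n}\in G$ we have $w(g_{1},\ldots,g_{n})=1$, i.e. $P(G,w)=|\{(g_1,\ldots,g_n)\in G^n : w(g_1,\ldots,g_n)=1\}|/|G|^n$; this depends only on the word $w$ and not on the choice of $n$, so it is defined for all $w\in F_\infty$. *)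

(* Defs.v *)
From HB Require Import structures.
From mathcomp Require Import all_boot all_order all_algebra all_fingroup.
From mathcomp Require Import all_solvable.
From mathcomp Require Import classical_sets set_interval reals topology normedtype.

Set Implicit Arguments.
Unset Strict Implicit.
Unset Printing Implicit Defensive.

Local Open Scope group_scope.

(* The letter (x, false) is the generator x, the letter (x, true) its inverse. *)
Definition letter (T : choiceType) : choiceType := (T * bool)%type.

Definition flip (T : choiceType) (a : letter T) : letter T := (a.1, ~~ a.2).

Definition reduced (T : choiceType) (w : seq (letter T)) : bool :=
  sorted (fun a b => b != flip a) w.

(* Each element of the free group is represented by its reduced word. *)
Record free_group (T : choiceType) := FreeGroup {
  word_of :> seq (letter T);
  word_of_reduced : reduced word_of
}.

HB.instance Definition _ (T : choiceType) := [isSub for @word_of T].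
HB.instance Definition _ (T : choiceType) := [Choice of free_group T by <:].

(* Left multiplication by a letter, for [w] reduced. *)
Definition push (T : choiceType) (a : letter T) (w : seq (letter T)) :=
  if w is b :: w' then if b == flip a then w' else a :: w else [:: a].

Definition catr (T : choiceType) (v w : seq (letter T)) : seq (letter T) :=
  foldr (@push T) w v.

Lemma flipK (T : choiceType) : involutive (@flip T).
Proof. by case=> x b; rewrite /flip /= negbK. Qed.

Lemma reduced_cons (T : choiceType) (a : letter T) w :
  reduced (a :: w) -> reduced w.
Proof. exact: path_sorted. Qed.

Lemma push_reduced (T : choiceType) (a : letter T) w :
  reduced w -> reduced (push a w).
Proof.
case: w => [|b w] //= red_w; case: ifP => [_|/negbT ne]; first exact: path_sorted red_w.
by rewrite /reduced /= ne.
Qed.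

Lemma push_cons (T : choiceType) (a : letter T) w :
  reduced (a :: w) -> push a w = a :: w.
Proof. by case: w => //= b w /andP[/negbTE-> _]. Qed.

Lemma flip_push (T : choiceType) (a : letter T) w :
  reduced w -> push (flip a) (push a w) = w.
Proof.
case: w => [_|b w] /=; first by rewrite flipK eqxx.
case: ifP => [/eqP-> red_w|_ _]; last by rewrite /= flipK eqxx.
exact: push_cons.
Qed.

Lemma catr_reduced (T : choiceType) (v w : seq (letter T)) :
  reduced w -> reduced (catr v w).
Proof. by elim: v => //= a v IHv red_w; apply/push_reduced/IHv. Qed.

Lemma catr_push (T : choiceType) (a : letter T) v w :
  reduced w -> catr (push a v) w = push a (catr v w).
Proof.
case: v => //= b v red_w; case: ifP => [/eqP->|//].
by have /esym := flip_push (flip a) (catr_reduced v red_w); rewrite flipK.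
Qed.

Lemma catrA (T : choiceType) (u v w : seq (letter T)) :
  reduced w -> catr u (catr v w) = catr (catr u v) w.
Proof. by move=> red_w; elim: u => //= a u ->; rewrite catr_push. Qed.

Lemma catr_nil (T : choiceType) (w : seq (letter T)) :
  reduced w -> catr w [::] = w.
Proof.
elim: w => //= a w IHw red_w.
by rewrite IHw ?push_cons //; apply: reduced_cons red_w.
Qed.

Definition invr (T : choiceType) (w : seq (letter T)) : seq (letter T) :=
  rev (map (@flip T) w).

Lemma invr_reduced (T : choiceType) (w : seq (letter T)) :
  reduced w -> reduced (invr w).
Proof.
rewrite /reduced /invr rev_sorted sorted_map; apply: sub_sorted => a b /=.
by apply: contra => /eqP h; rewrite -[b]flipK -h.
Qed.

Lemma invrK (T : choiceType) : involutive (@invr T).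
Proof. by move=> w; rewrite /invr map_rev revK (mapK (@flipK T)). Qed.

Lemma catr_inv (T : choiceType) (w : seq (letter T)) :
  catr (invr w) w = [::].
Proof.
elim: w => //= a w IHw.
by rewrite /invr /= rev_cons /catr foldr_rcons /= flipK eqxx.
Qed.

Definition fg_one (T : choiceType) : free_group T :=
  FreeGroup (isT : reduced [::]).

Definition fg_mul (T : choiceType) (v w : free_group T) : free_group T :=
  FreeGroup (catr_reduced v (word_of_reduced w)).

Definition fg_inv (T : choiceType) (w : free_group T) : free_group T :=
  FreeGroup (invr_reduced (word_of_reduced w)).

Lemma fg_mulA (T : choiceType) : associative (@fg_mul T).
Proof. by move=> u v w; apply/val_inj/catrA/word_of_reduced. Qed.

Lemma fg_mul1 (T : choiceType) : left_id (@fg_one T) (@fg_mul T).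
Proof. by move=> w; apply: val_inj. Qed.

Lemma fg_mulr1 (T : choiceType) : right_id (@fg_one T) (@fg_mul T).
Proof. by move=> w; apply/val_inj/catr_nil/word_of_reduced. Qed.

Lemma fg_mulV (T : choiceType) :
  left_inverse (@fg_one T) (@fg_inv T) (@fg_mul T).
Proof. by move=> w; apply/val_inj/catr_inv. Qed.

Lemma fg_mulrV (T : choiceType) :
  right_inverse (@fg_one T) (@fg_inv T) (@fg_mul T).
Proof.
by move=> w; apply: val_inj; rewrite /= -{1}[word_of w]invrK catr_inv.
Qed.

HB.instance Definition _ (T : choiceType) :=
  isGroup.Build (free_group T) (@fg_mulA T) (@fg_mul1 T) (@fg_mulr1 T)
    (@fg_mulV T) (@fg_mulrV T).

Definition fg_gen (T : choiceType) (x : T) : free_group T :=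
  FreeGroup (isT : reduced [:: ((x, false) : letter T)]).

Definition letter_eval (T : choiceType) (H : groupType) (g : T -> H)
    (a : letter T) : H := if a.2 then (g a.1)^-1 else g a.1.

Definition word_eval (T : choiceType) (H : groupType) (g : T -> H)
    (w : free_group T) : H :=
  foldr (fun a h => letter_eval g a * h) 1 w.

Lemma word_evalM (T : choiceType) (H : groupType) (g : T -> H) :
  {morph word_eval g : v w / v * w}.
Proof.
move=> [v redv] w; rewrite /word_eval /=.
elim: v {redv} => [|a v IHv] /=; first by rewrite mul1g.
rewrite -mulgA -IHv; case: (catr v w) => //= b u.
case: ifP => //= /eqP->; rewrite mulgA /letter_eval /=.
by case: a.2; rewrite ?mulgV ?mulVg mul1g.
Qed.

Lemma word_eval_gen (T : choiceType) (H : groupType) (g : T -> H) (x : T) :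
  word_eval g (fg_gen x) = g x.
Proof. exact: mulg1. Qed.

Lemma word_eval_uniq (T : choiceType) (H : groupType) (g : T -> H)
    (f : free_group T -> H) :
  {morph f : v w / v * w} -> (forall x, f (fg_gen x) = g x) ->
  f =1 word_eval g.
Proof.
move=> fM fg.
have f1 : f 1 = 1 by apply: (mulgI (f 1)); rewrite -fM !mulg1.
have fV v : f v^-1 = (f v)^-1.
  by apply: (mulgI (f v)); rewrite -fM !mulgV.
case=> w; elim: w => [|a w IHw] red_aw.
  by rewrite -[RHS]f1; congr f; apply: val_inj.
have red_w := reduced_cons red_aw.
pose x := if a.2 then (fg_gen a.1)^-1 else fg_gen a.1.
have -> : FreeGroup red_aw = x * FreeGroup red_w.
  apply: val_inj; rewrite /= -push_cons // /x.
  by case: a {red_aw x} => y [].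
rewrite fM word_evalM IHw; congr (_ * _).
by rewrite /x; case: a.2; rewrite ?fV fg; apply/esym/mulg1.
Qed.

Definition F_inf : groupType := free_group nat.

(* [F_n] is identified with the subgroup of [F_inf] of the elements whose
   reduced word only involves the letters [0, .., n.-1]. *)
Definition F_ (n : nat) : {pred F_inf} :=
  [pred w : F_inf | all (fun a => (a.1 < n)%N) (word_of w)].

(* The least [n] such that [w] lies in [F_ n]. *)
Definition word_rank (w : F_inf) : nat := \max_(a <- word_of w) a.1.+1.

(* The value at the letters outside [0, .., n.-1] is irrelevant for [w \in F_ n]. *)
Definition letter_value (gT : finGroupType) (n : nat) (g : {ffun 'I_n -> gT})
    (i : nat) : gT := oapp g 1 (insub i).

Definition solution_set (gT : finGroupType) (G : {group gT}) (n : nat)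
    (w : F_inf) : {set {ffun 'I_n -> gT}} :=
  [set g in ffun_on (mem G) | word_eval (letter_value g) w == 1].

Definition word_prob_in (R : realType) (gT : finGroupType) (G : {group gT})
    (n : nat) (w : F_inf) : R :=
  (#|solution_set G n w|%:R / (#|G| ^ n)%N%:R)%R.

Definition word_prob (R : realType) (gT : finGroupType) (G : {group gT})
    (w : F_inf) : R := word_prob_in R G (word_rank w) w.

Lemma in_F_rank (n : nat) (w : F_inf) : (w \in F_ n) = (word_rank w <= n)%N.
Proof.
apply/allP/bigmax_leqP_seq => [h a wa _|h a wa]; [exact: h|exact: h].
Qed.

Lemma eq_word_eval (H : groupType) (f g : nat -> H) (n : nat) (w : F_inf) :
  w \in F_ n -> (forall i, (i < n)%N -> f i = g i) ->
  word_eval f w = word_eval g w.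
Proof.
case: w => w red_w; rewrite inE /= => wn fg; rewrite /word_eval /=.
elim: w {red_w} wn => //= a w IHw /andP[an wn].
by rewrite IHw // /letter_eval fg.
Qed.

Lemma card_solution_setS (gT : finGroupType) (G : {group gT}) (n : nat)
    (w : F_inf) :
  w \in F_ n -> #|solution_set G n.+1 w| = (#|solution_set G n w| * #|G|)%N.
Proof.
move=> wn; rewrite -cardsX.
pose ext (p : {ffun 'I_n -> gT} * gT) : {ffun 'I_n.+1 -> gT} :=
  [ffun i => oapp p.1 p.2 (unlift ord_max i)].
have extE p i : ext p (lift ord_max i) = p.1 i by rewrite ffunE liftK.
have ext_max p : ext p ord_max = p.2 by rewrite ffunE unlift_none.
have ext_inj : injective ext.
  move=> [f x] [g y] /ffunP fg; congr pair; last first.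
    by have := fg ord_max; rewrite !ext_max.
  by apply/ffunP => i; have := fg (lift ord_max i); rewrite !extE.
have evE p : word_eval (letter_value (ext p)) w = word_eval (letter_value p.1) w.
  apply: (eq_word_eval wn) => i ltin; rewrite /letter_value.
  rewrite (insubT (fun k => k < n.+1)%N (ltnW ltin)) (insubT (fun k => k < n)%N ltin) /=.
  rewrite -extE; congr (ext p _); apply: val_inj => /=.
  by rewrite /bump leqNgt ltin.
rewrite -(card_imset _ ext_inj); apply: eq_card => h; rewrite !inE.
apply/andP/imsetP => [[/ffun_onP hG hw]|[p]].
  exists ([ffun i => h (lift ord_max i)], h ord_max).
    have hE : h = ext ([ffun i => h (lift ord_max i)], h ord_max).
      apply/ffunP => i; rewrite ffunE.
      by case: unliftP => [j|] -> //=; rewrite ffunE.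
    rewrite !inE /= hG andbT; apply/andP; split.
      by apply/ffun_onP => i; rewrite ffunE; apply: hG.
    by move: hw; rewrite {1}hE evE.
  apply/ffunP => i; rewrite ffunE.
  by case: unliftP => [j|] -> //=; rewrite ffunE.
rewrite !inE => /andP[/andP[/ffun_onP pG pw] pxG] ->; split; last by rewrite evE.
by apply/ffun_onP => i; rewrite ffunE; case: unliftP => [j|] _ //=; apply: pG.
Qed.

Lemma word_prob_inE (R : realType) (gT : finGroupType) (G : {group gT})
    (n : nat) (w : F_inf) :
  w \in F_ n -> word_prob_in R G n w = word_prob R G w.
Proof.
rewrite in_F_rank => /subnKC <-; elim: (n - word_rank w)%N => [|k IHk].
  by rewrite addn0.
rewrite addnS -IHk /word_prob_in card_solution_setS ?in_F_rank ?leq_addr //.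
have G0 : (#|G|%:R != 0 :> R)%R by rewrite Num.Theory.pnatr_eq0 -lt0n cardG_gt0.
by rewrite expnSr !GRing.natrM GRing.invfM GRing.mulrACA GRing.divff // GRing.mulr1.
Qed.

Definition just_nonsolvable (gT : finGroupType) (G : {group gT}) : Prop :=
  (forall N : {group gT}, N <| G -> N :!=: 1 -> solvable (G / N)) /\
  ~~ solvable G.

Definition dense_in (T : topologicalType) (A S : set T) : Prop :=
  (S `<=` A /\ A `<=` closure S)%classic.

(* Main.v *)
Require Import Defs.
From mathcomp Require Import boolp classical_sets set_interval reals topology normedtype.
From mathcomp Require Import all_boot all_order all_algebra all_fingroup.
From mathcomp Require Import all_solvable.
From mathcomp Require Import lra.
Import numFieldNormedType.Exports.

(** A tuple [g] in [G ^ n] gives an evaluation homomorphism [F_n -> G], which is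
onto exactly when [g] generates [G].  As [n] grows, almost every tuple
generates: a tuple that does not lies in [H ^ n] for some proper subgroup [H],
and each [H ^ n] has density at most [2 ^ -n] ([card_non_gen_tuples]).  So only
the generating tuples that solve [w = 1] matter, and it is enough that the set
they form can be cut down from everything to nothing in steps of size bounded
independently of [n]; a discrete intermediate value argument
([gen_solutions_near]) then puts the number of solutions close to any
prescribed number, with relative error [O(2 ^ -n)].

A step is as follows.  Let [g] be a generating solution of [w = 1], and let [E]
be the set of the generating [h] whose evaluation kernel is contained in that
of [g].  Two surjections of [F_n] onto the finite group [G] with nested kernels
have equal kernels, hence differ by an automorphism of [G]; so [E] has bounded
size and consists of solutions of [w = 1].  If [u] is a word with [u(g) <> 1]
that vanishes on every generating tuple outside [E], then the generating
solutions of [w u = 1] are those of [w = 1] with [E] removed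
([remove_kernel_below]).

The word [u] is where just non-solvability enters ([separating_word]).  The
values at [g] of the words that vanish on a set [Y] of tuples form a normal
subgroup [K_Y] of [G].  For [Y = {h}] with [h] outside [E] it is nontrivial by
definition of [E], and [[K_X, K_Y]] lies in the subgroup of [X :|: Y], because
the commutator of two words vanishes wherever one of them does.  In a just
non-solvable group two nontrivial normal subgroups have a nontrivial
commutator ([commg_just_nonsolvable]), so the subgroup of the complement of
[E], built up one tuple at a time, is never trivial. *)

Set Implicit Arguments.
Unset Strict Implicit.
Unset Printing Implicit Defensive.

Local Open Scope group_scope.

(** * Just non-solvable groups *)

(** [G / A] and [G / B] are solvable, so a term of the derived series of [G]
lies in both [A] and [B], and the next one in [[A, B]]: were this trivial, [G]
would be solvable. *)
Lemma commg_just_nonsolvable (gT : finGroupType) (G A B : {group gT}) :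
  just_nonsolvable G -> A <| G -> B <| G -> A :!=: 1 -> B :!=: 1 ->
  [~: A, B] != 1.
Proof.
move=> [solq nsolG] nAG nBG A1 B1; apply: contraNneq nsolG => cAB.
have derS (H : {group gT}) : H <| G -> H :!=: 1 -> exists n, G^`(n) \subset H.
  move=> nHG H1; have /derivedP[n] := solq H nHG H1.
  have nH : G^`(n) \subset 'N(H).
    exact: (subset_trans (der_sub n G) (normal_norm nHG)).
  rewrite -quotient_der ?normal_norm // => /trivgP.
  by rewrite quotient_sub1 //; exists n.
have derD m k : G^`(m + k) \subset G^`(m).
  elim: k => [|k IHk]; first by rewrite addn0.
  by rewrite addnS; apply: (subset_trans (der_subS (m + k) G) IHk).
have [a Ga] := derS A nAG A1; have [b Gb] := derS B nBG B1.
apply/derivedP; exists (a + b).+1; apply/trivgP; rewrite /= -cAB dergSn commgSS //.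
  exact: subset_trans Ga.
by rewrite addnC; apply: subset_trans Gb.
Qed.

Lemma card_just_nonsolvable_gt1 (gT : finGroupType) (G : {group gT}) :
  just_nonsolvable G -> 1 < #|G|.
Proof.
case=> _; rewrite cardG_gt1; apply: contraNneq => ->; exact: solvable1.
Qed.

(** * Words and their values at a tuple *)

Lemma leq_expn (a b k : nat) : a <= b -> a ^ k <= b ^ k.
Proof. by case: k => // k ab; rewrite leq_exp2r. Qed.

Lemma word_evalV (T : choiceType) (H : groupType) (g : T -> H) w :
  word_eval g w^-1 = (word_eval g w)^-1.
Proof. by apply: (mulgI (word_eval g w)); rewrite -word_evalM !mulgV. Qed.

Section WordsInF.

Variable n : nat.

Lemma F_M v w : v \in F_ n -> w \in F_ n -> v * w \in F_ n.
Proof.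
rewrite !inE /=; case: v => v /= _; elim: v => //= a v IHv /andP[an vn] wn.
have {IHv} := IHv vn wn; case: (catr v w) => /= [|b u]; first by rewrite an.
by case/andP=> bn un; case: ifP => _ //=; rewrite an bn.
Qed.

Lemma F_V w : w \in F_ n -> w^-1 \in F_ n.
Proof. by rewrite !inE /= /invr all_rev all_map. Qed.

End WordsInF.

Section Evaluation.

Variables (gT : finGroupType) (n : nat).
Implicit Types (G : {group gT}) (g h : {ffun 'I_n -> gT}).
Implicit Types (X Y : {set {ffun 'I_n -> gT}}) (w : F_inf).

Definition eval_at g (w : F_inf) : gT := word_eval (letter_value g) w.

Lemma eval_atM g v w : eval_at g (v * w) = eval_at g v * eval_at g w.
Proof. exact: word_evalM. Qed.

Lemma eval_atV g w : eval_at g w^-1 = (eval_at g w)^-1.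
Proof. exact: word_evalV. Qed.

Lemma eval_at1 g : eval_at g 1 = 1. Proof. by []. Qed.

Lemma eval_at_gen g (i : 'I_n) : eval_at g (fg_gen (i : nat)) = g i.
Proof. by rewrite /eval_at word_eval_gen /letter_value valK. Qed.

Definition gen_tuples G : {set {ffun 'I_n -> gT}} :=
  [set g : {ffun 'I_n -> gT} | <<[set g i | i : 'I_n]>> == G].

Lemma gen_tuples_ffun_on G g : g \in gen_tuples G -> g \in ffun_on (mem G).
Proof.
rewrite inE => /eqP gG; apply/ffun_onP => i.
by rewrite -gG mem_gen // imset_f.
Qed.

(** The image of the set of words vanishing on [Y] under evaluation at [g]: it
measures how far [g] can be told apart from the tuples of [Y]. *)
Definition vals_killing (Y : {set {ffun 'I_n -> gT}}) g : {set gT} :=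
  [set x | `[< exists w,
    [/\ w \in F_ n, {in Y, forall h, eval_at h w = 1} & eval_at g w = x] >]].

Lemma vals_killingP Y g x :
  reflect (exists w,
      [/\ w \in F_ n, {in Y, forall h, eval_at h w = 1} & eval_at g w = x])
    (x \in vals_killing Y g).
Proof. by rewrite inE; apply: asboolP. Qed.

Lemma vals_killing_group_set Y g : group_set (vals_killing Y g).
Proof.
apply/group_setP; split; first by apply/vals_killingP; exists 1.
move=> _ _ /vals_killingP[v [vn vY <-]] /vals_killingP[w [wn wY <-]].
apply/vals_killingP.
exists (v * w); split; [exact: F_M| |exact: eval_atM].
by move=> h hY; rewrite eval_atM vY ?wY ?mulg1.
Qed.

Canonical vals_killing_group Y g := Group (vals_killing_group_set Y g).

Lemma gen_vals_killing0 g : <<[set g i | i : 'I_n]>> = vals_killing set0 g.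
Proof.
apply/eqP; rewrite eqEsubset gen_subG; apply/andP; split.
  apply/subsetP => _ /imsetP[i _ ->]; apply/vals_killingP.
  exists (fg_gen (i : nat)); split; [by rewrite inE /= ltn_ord| |exact: eval_at_gen].
  by move=> h; rewrite in_set0.
apply/subsetP => _ /vals_killingP[w [_ _ <-]]; rewrite /eval_at /word_eval.
elim: (word_of w) => //= a s IHs.
rewrite groupM // {IHs} /letter_eval /letter_value.
case: insubP => [i _ _|_] /=; last by rewrite invg1 if_same group1.
by case: a.2; rewrite ?groupV mem_gen // imset_f.
Qed.

Lemma gen_tuplesP G g : reflect (vals_killing set0 g = G) (g \in gen_tuples G).
Proof. by rewrite inE gen_vals_killing0; apply: eqP. Qed.

Lemma eval_at_gen_tuple G g w : g \in gen_tuples G -> w \in F_ n -> eval_at g w \in G.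
Proof.
move/gen_tuplesP <- => wn; apply/vals_killingP; exists w; split=> // h.
by rewrite in_set0.
Qed.

Lemma gen_tuple_eval_onto G g x :
  g \in gen_tuples G -> x \in G -> exists2 w, w \in F_ n & eval_at g w = x.
Proof. by move/gen_tuplesP <- => /vals_killingP[w [wn _ <-]]; exists w. Qed.

Lemma vals_killing_normal G Y g : g \in gen_tuples G -> vals_killing Y g <| G.
Proof.
move=> gG; apply/andP; split.
  by apply/subsetP => _ /vals_killingP[w [wn _ <-]]; apply: eval_at_gen_tuple.
apply/subsetP => _ /(gen_tuple_eval_onto gG)[v vn <-]; rewrite inE.
apply/subsetP => _ /imsetP[_ /vals_killingP[w [wn wY <-]] ->]; apply/vals_killingP.
exists (w ^ v); rewrite !conjgE; split; first by rewrite !(F_M, F_V).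
  by move=> h hY; rewrite !(eval_atM, eval_atV) wY // mul1g mulVg.
by rewrite !(eval_atM, eval_atV).
Qed.

(** A commutator of words vanishes wherever either of the two words does. *)
Lemma commg_vals_killing X Y g :
  [~: vals_killing X g, vals_killing Y g] \subset vals_killing (X :|: Y) g.
Proof.
rewrite gen_subG; apply/subsetP => _
  /imset2P[_ _ /vals_killingP[v [vn vX <-]] /vals_killingP[w [wn wY <-]] ->].
apply/vals_killingP.
exists [~ v, w]; rewrite commgEl conjgE; split.
- by rewrite !(F_M, F_V).
- move=> h; rewrite inE !(eval_atM, eval_atV) => /orP[/vX|/wY] ->.
    by rewrite invg1 !mul1g mulVg.
  by rewrite invg1 mulg1 mul1g mulVg.
- by rewrite commgEl conjgE !(eval_atM, eval_atV).
Qed.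

(** * Generating tuples with the same kernel *)

(** The condition says that the kernel of evaluation at [h] is contained in that
of evaluation at [g]. *)
Definition kernel_below G g : {set {ffun 'I_n -> gT}} :=
  [set h in gen_tuples G | vals_killing [set h] g == 1].

Lemma kernel_below_refl G g : g \in gen_tuples G -> g \in kernel_below G g.
Proof.
move=> gG; rewrite inE gG; apply/eqP/trivgP/subsetP => _ /vals_killingP[w [_ wg <-]].
by rewrite wg ?set11 // group1.
Qed.

Lemma kernel_below_ker G g h w :
  h \in kernel_below G g -> w \in F_ n -> eval_at h w = 1 -> eval_at g w = 1.
Proof.
rewrite inE => /andP[_ /eqP h1] wn hw.
have : eval_at g w \in vals_killing [set h] g.
  by apply/vals_killingP; exists w; split=> // k /set1P->.
by rewrite h1 => /set1P.
Qed.

(** Each [h] to be killed contributes a nontrivial normal subgroup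
[vals_killing [set h] g]; commutators kill all of them at once without becoming
trivial. *)
Lemma separating_word G g : just_nonsolvable G -> g \in gen_tuples G ->
  exists w, [/\ w \in F_ n, eval_at g w != 1 &
    {in gen_tuples G :\: kernel_below G g, forall h, eval_at h w = 1}].
Proof.
move=> jnsG gG.
suff H (s : seq {ffun 'I_n -> gT}) :
    {subset s <= gen_tuples G :\: kernel_below G g} ->
    vals_killing [set h in s] g != 1.
  have /H : {subset enum (gen_tuples G :\: kernel_below G g)
      <= gen_tuples G :\: kernel_below G g}.
    by move=> h; rewrite mem_enum.
  rewrite set_enum => /trivgPn[_ /vals_killingP[w [wn w1 <-]] gw1].
  by exists w.
elim: s => [|h s IHs] sub.
  rewrite set_nil (gen_tuplesP _ _ gG).
  by case: jnsG => _; apply: contraNneq => ->; apply: solvable1.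
have /IHs s1 : {subset s <= gen_tuples G :\: kernel_below G g}.
  by move=> k ks; apply: sub; rewrite inE ks orbT.
have h1 : vals_killing [set h] g != 1.
  have := sub h; rewrite mem_head => /(_ isT).
  by rewrite in_setD inE => /andP[+ hG]; rewrite hG.
have nY Y := vals_killing_normal Y gG.
have := commg_just_nonsolvable jnsG (nY _) (nY _) h1 s1.
apply: contraNneq => E; rewrite set_cons in E.
by rewrite -subG1 -E commg_vals_killing.
Qed.

(** Inclusion of kernels gives a well-defined map from the values at [h] to the
values at [g].  As both tuples generate [G], it is a surjection of the finite
set [G] onto itself, hence injective, and the kernels are equal. *)
Lemma kernel_below_ker_sym G g h w : g \in gen_tuples G ->
  h \in kernel_below G g -> w \in F_ n -> eval_at g w = 1 -> eval_at h w = 1.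
Proof.
move=> gG hg wn gw.
have hG : h \in gen_tuples G by move: hg; rewrite inE => /andP[].
(* [word y] is a word with value [y] at [h]; its value at [g] is the image of [y]. *)
have [|word wordP] :=
    @choice gT F_inf (fun y w => y \in G -> w \in F_ n /\ eval_at h w = y).
  move=> y.
  have [/(gen_tuple_eval_onto hG)[v vn hv]|] := boolP (y \in G); last by exists 1.
  by exists v.
pose f y := eval_at g (word y).
have fE v : v \in F_ n -> f (eval_at h v) = eval_at g v.
  move=> vn; have [un uE] := wordP _ (eval_at_gen_tuple hG vn).
  apply/eqP; rewrite eq_mulgV1 -eval_atV -eval_atM; apply/eqP/(kernel_below_ker hg).
    by rewrite F_M // F_V.
  by rewrite eval_atM eval_atV uE mulgV.
have injf : {in G &, injective f}.
  apply/imset_injP; rewrite eqn_leq leq_imset_card /=.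
  apply/subset_leq_card/subsetP => _ /(gen_tuple_eval_onto gG)[v vn <-].
  by apply/imsetP; exists (eval_at h v); rewrite ?fE // (eval_at_gen_tuple hG).
apply: injf; rewrite ?group1 ?(eval_at_gen_tuple hG) // fE // gw.
by rewrite -(eval_at1 h) fE.
Qed.

(** The isomorphism between the images of two homomorphisms with the same kernel
sends [g] to [h]: a member of [kernel_below G g] is [g] followed by a function
from [gT] to itself, and the number of those does not depend on [n]. *)
Lemma card_kernel_below G g : g \in gen_tuples G ->
  #|kernel_below G g| <= #|{ffun gT -> gT}|.
Proof.
move=> gG.
pose F (f : {ffun gT -> gT}) : {ffun 'I_n -> gT} := [ffun i => f (g i)].
apply: leq_trans (leq_imset_card F predT); apply/subset_leq_card/subsetP => h hg.
pose f : {ffun gT -> gT} :=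
  [ffun x => if [pick i | g i == x] is Some i then h i else 1].
apply/imsetP; exists f => //; apply/ffunP => i; rewrite !ffunE.
case: pickP => [j /eqP gji|/(_ i)]; last by rewrite eqxx.
apply/eqP; rewrite eq_mulgV1 -!eval_at_gen -eval_atV -eval_atM; apply/eqP.
have genF (k : 'I_n) : (fg_gen (k : nat) : F_inf) \in F_ n.
  by rewrite inE /= ltn_ord.
apply: (kernel_below_ker_sym gG hg); first by rewrite F_M ?F_V.
by rewrite eval_atM eval_atV !eval_at_gen gji mulgV.
Qed.

(** * Adjusting the number of solutions *)

Definition gen_solutions G w : {set {ffun 'I_n -> gT}} :=
  [set g in gen_tuples G | eval_at g w == 1].

Lemma remove_kernel_below G g w : just_nonsolvable G -> w \in F_ n ->
  g \in gen_solutions G w ->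
  exists2 v, v \in F_ n &
    gen_solutions G v = gen_solutions G w :\: kernel_below G g.
Proof.
move=> jnsG wn; rewrite inE => /andP[gG /eqP gw].
have [u [un gu hu]] := separating_word jnsG gG.
exists (w * u); first exact: F_M.
apply/setP => h; rewrite in_setD ![h \in gen_solutions _ _]inE eval_atM.
have [hG|] := boolP (h \in gen_tuples G); last by rewrite andbF.
have [hg|hg] /= := boolP (h \in kernel_below G g).
  rewrite (kernel_below_ker_sym gG hg wn gw) mul1g.
  by apply: contraNF gu => /eqP /(kernel_below_ker hg un) ->.
by rewrite hu ?mulg1 // inE hg.
Qed.

(** Discrete intermediate value: starting from the trivial word, solutions are
removed by [remove_kernel_below] until at most [m] are left, and each step
removes at most as many as there are functions from [gT] to itself.  The
minimum is there because the process starts at [#|gen_tuples G|], which may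
already be below [m]. *)
Lemma gen_solutions_near G m : just_nonsolvable G ->
  exists w, [/\ w \in F_ n, #|gen_solutions G w| <= m &
    minn m #|gen_tuples G| <= #|gen_solutions G w| + #|{ffun gT -> gT}|].
Proof.
move=> jnsG; set b := #|{ffun _}|.
(* Every step removes at least one solution, so that the bound [k] decreases. *)
suff H k w : w \in F_ n -> #|gen_solutions G w| <= k ->
    minn m #|gen_tuples G| <= #|gen_solutions G w| + b ->
    exists v, [/\ v \in F_ n, #|gen_solutions G v| <= m &
      minn m #|gen_tuples G| <= #|gen_solutions G v| + b].
  apply: (H #|gen_solutions G 1| 1) => //; apply: leq_trans (geq_minr _ _) _.
  apply: leq_trans (leq_addr _ _); apply/subset_leq_card/subsetP => g gG.
  by rewrite inE gG eval_at1 eqxx.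
elim: k w => [|k IHk] w wn wk wb.
  by exists w; split=> //; apply: leq_trans wk _.
have [wm|mw] := leqP #|gen_solutions G w| m; first by exists w.
have /card_gt0P[g gw] : 0 < #|gen_solutions G w| by apply: leq_ltn_trans mw.
have gG : g \in gen_tuples G by move: gw; rewrite inE => /andP[].
have [v vn vE] := remove_kernel_below jnsG wn gw.
have wE := cardsID (kernel_below G g) (gen_solutions G w).
apply: (IHk v vn); rewrite vE.
  rewrite -ltnS; apply: leq_trans wk; rewrite -wE -add1n leq_add2r.
  by apply/card_gt0P; exists g; rewrite inE gw kernel_below_refl.
rewrite geq_min; apply/orP; left; apply: leq_trans (ltnW mw) _.
rewrite -wE addnC leq_add2l; apply: leq_trans (card_kernel_below gG).
exact/subset_leq_card/subsetIr.
Qed.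

(** A tuple that does not generate [G] lies in [H ^ n] for some proper subgroup
[H], and [#|H| * 2 <= #|G|] by Lagrange. *)
Lemma card_non_gen_tuples G :
  #|[set g in ffun_on (mem G)] :\: gen_tuples G| * 2 ^ n
    <= #|{group gT}| * #|G| ^ n.
Proof.
have cover : [set g in ffun_on (mem G)] :\: gen_tuples G \subset
    \bigcup_(H : {group gT} | H \proper G)
      [set g : {ffun 'I_n -> gT} in ffun_on (mem H)].
  apply/subsetP => g; rewrite in_setD [g \in [set _ in _]]inE.
  case/andP=> gG /ffun_onP Gg.
  apply/bigcupP; exists <<[set g i | i : 'I_n]>>%G.
    rewrite properEneq; apply/andP; split; first by rewrite inE in gG.
    by rewrite gen_subG; apply/subsetP => _ /imsetP[i _ ->]; apply: Gg.
  by rewrite inE; apply/ffun_onP => i; rewrite mem_gen // imset_f.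
apply: leq_trans (leq_mul (subset_leq_card cover) (leqnn _)) _.
apply: (@leq_trans (\sum_(H : {group gT} | H \proper G) #|H| ^ n * 2 ^ n)).
  rewrite -big_distrl /= leq_mul2r; apply/orP; right.
  elim/big_rec2: _ => [|H k A _ IH]; first by rewrite cards0.
  apply: leq_trans (leq_card_setU _ _) (leq_add _ IH).
  by rewrite cardsE card_ffun_on card_ord.
rewrite -sum_nat_const big_mkcond leq_sum // => H _; case: ifP => // prHG.
rewrite -expnMn leq_expn //.
have := Lagrange (proper_sub prHG) => <-; rewrite leq_mul2l indexg_gt1.
by rewrite proper_subn ?orbT.
Qed.

(** The error [e] comes from the size of a removal step and from the tuples that
do not generate [G], where nothing is known about the word.  Its ratio to
[#|G| ^ n] is at most a constant, independent of [n], times [2 ^ -n]. *)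
Lemma card_solutions_approx G m : just_nonsolvable G -> m <= #|G| ^ n ->
  exists w e, [/\ w \in F_ n, #|solution_set G n w| <= m + e,
    m <= #|solution_set G n w| + e &
    e * 2 ^ n <= (#|{ffun gT -> gT}| + #|{group gT}|) * #|G| ^ n].
Proof.
move=> jnsG mG.
set N := [set g in ffun_on (mem G)] :\: gen_tuples G.
have [w [wn wm mw]] := gen_solutions_near m jnsG.
have gensN : (#|gen_tuples G| + #|N| = #|G| ^ n)%N.
  have := cardsID (gen_tuples G) [set g in ffun_on (mem G)].
  rewrite [#|[set g in ffun_on _]|]cardsE card_ffun_on card_ord (setIidPr _) //.
  by apply/subsetP => g /gen_tuples_ffun_on gG; rewrite inE.
have solN : #|solution_set G n w| <= #|gen_solutions G w| + #|N|.
  apply: leq_trans (leq_card_setU _ _); apply/subset_leq_card/subsetP => g.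
  rewrite inE => /andP[gG gw]; rewrite in_setU in_setD [g \in gen_solutions _ _]inE.
  by case: (g \in gen_tuples G) => /=; rewrite ?inE ?gw ?gG.
have solG : #|gen_solutions G w| <= #|solution_set G n w|.
  apply/subset_leq_card/subsetP => g.
  by rewrite inE => /andP[/gen_tuples_ffun_on gG gw]; rewrite inE gG.
exists w, (#|{ffun gT -> gT}| + #|N|)%N; split=> //.
- apply: leq_trans solN _; rewrite addnA leq_add2r.
  exact: leq_trans wm (leq_addr _ _).
- move: mw; rewrite geq_min => /orP[mw|Gw].
    rewrite addnA; apply: leq_trans mw (leq_trans _ (leq_addr _ _)).
    by rewrite leq_add2r.
  apply: leq_trans mG _; rewrite -gensN addnA leq_add2r.
  by apply: leq_trans Gw _; rewrite leq_add2r.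
- rewrite !mulnDl leq_add ?card_non_gen_tuples // leq_mul2l.
  by rewrite leq_expn ?orbT // card_just_nonsolvable_gt1.
Qed.

End Evaluation.

Import Order.TTheory GRing.Theory Num.Theory.

Local Open Scope ring_scope.
Local Open Scope classical_set_scope.

(** * Density *)

Lemma word_prob_itv (R : realType) (gT : finGroupType) (G : {group gT}) w :
  0 <= word_prob R G w <= 1.
Proof.
rewrite /word_prob /word_prob_in divr_ge0 ?ler0n //=.
rewrite ler_pdivrMr ?mul1r ?ler_nat ?ltr0n ?expn_gt0 ?cardG_gt0 //.
rewrite -[X in (_ <= _ ^ X)%N]card_ord -(card_ffun_on _ (mem G)).
by apply/subset_leq_card/fintype.subsetP => g; rewrite inE => /andP[].
Qed.

Theorem theorem3 (R : realType) (gT : finGroupType) (G : {group gT})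
    (hG : just_nonsolvable G) :
  dense_in `[0 : R, 1 : R] [set word_prob R G w | w in [set: F_inf]].
Proof.
split=> [_ [w _ <-]|t]; first by rewrite /= in_itv /= word_prob_itv.
rewrite /= in_itv /= => /andP[t0 t1] B /nbhs_ballP[eps /= eps0 epsB].
pose C := (#|{ffun gT -> gT}| + #|{group gT}|)%N.
have [n Cn] : exists n, C.+1%:R < eps * (2 ^ n)%N%:R.
  exists (Num.bound (C.+1%:R / eps)); rewrite mulrC -ltr_pdivrMr // natrX.
  exact: upper_nthrootP.
set N : R := (#|G| ^ n)%N%:R.
have N0 : 0 < N by rewrite ltr0n expn_gt0 cardG_gt0.
have tN0 : 0 <= t * N by rewrite mulr_ge0 // ltW.
have /andP[mt tm] := truncn_itv tN0.
(* The number of solutions aimed at; rounding costs the extra [1] of [C.+1]. *)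
set m := Num.trunc (t * N) in mt tm.
have mN : (m <= #|G| ^ n)%N.
  by rewrite -(ler_nat R); apply: le_trans mt _; rewrite ler_piMl // ltW.
have [w [e [wn cm mc eC]]] := card_solutions_approx hG mN.
exists (word_prob R G w); split; first by exists w.
apply: epsB; rewrite /ball /= -(word_prob_inE R _ wn) /word_prob_in -/N.
rewrite -(ltr_pM2r N0) -[X in _ * X < _](ger0_norm (ltW N0)) -normrM mulrBl.
rewrite mulfVK ?gt_eqF //.
have e_lt : e%:R + 1 < eps * N.
  have p0 : 0 < (2 ^ n)%N%:R :> R by rewrite ltr0n expn_gt0.
  rewrite natr1 -(ltr_pM2r p0) mulrAC; apply: le_lt_trans (_ : C.+1%:R * N < _).
    rewrite -!natrM ler_nat mulSn [leqRHS]mulSn addnC [leqRHS]addnC leq_add //.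
    by apply: leq_expn; apply: card_just_nonsolvable_gt1.
  by rewrite ltr_pM2r.
have cmR : (#|solution_set G n w|%:R <= m%:R + e%:R :> R) by rewrite -natrD ler_nat.
have mcR : (m%:R <= #|solution_set G n w|%:R + e%:R :> R) by rewrite -natrD ler_nat.
rewrite -natr1 in tm; rewrite ltr_norml; apply/andP; split; lra.
Qed.
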